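(* Let $\mathrm{Ind}(H;X)$ denote the independence polynomial of hypergraphs. Then $\mathrm{Ind}$ is weakly distinguishing on hypergraphs and on $r$-uniform hypergraphs for $r\ge 2$, that is: (i) $$\lim_{n\to\infty}\frac{\mathcal{U}_{\mathrm{Ind}}(n)}{\mathcal{H}(n)}=0.$$ (ii) For every integer $r\ge 2$, $$\lim_{n\to\infty}\frac{\mathcal{U}^r_{\mathrm{Ind}}(n)}{\mathcal{H}^r(n)}=0.$$
   Context: A (finite) hypergraph $H$ consists of a finite vertex set $V(H)$ and a set $E(H)$ of subsets of $V(H)$, called hyperedges. $H$ is $r$-uniform if every hyperedge has exactly $r$ elements. Two hypergraphs are isomorphic if there is a bijection between their vertex sets under which a set of vertices is a hyperedge of the first iff its image is a hyperedge of the second. A set $I\subseteq V(H)$ is independent if there is no hyperedge $e\in E(H)$ with $e\subseteq I$. The independence polynomial is $\mathrm{Ind}(H;X)=\sum_i \mathrm{ind}_i(H)\,X^i$, where $\mathrm{ind}_i(H)$ is the number of independent sets $I\subseteq V(H)$ with $|I|=i$. For a univariate hypergraph polynomial $P$ (an isomorphism-invariant map from hypergraphs to $\mathbb{Z}[X]$): a hypergraph $H$ is $P$-unique if every hypergraph $H_1$ with $P(H_1;X)=P(H;X)$ is isomorphic to $H$; an $r$-uniform hypergraph $H$ is $r$-$P$-unique if every $r$-uniform hypergraph $H_1$ with $P(H_1;X)=P(H;X)$ is isomorphic to $H$. $\mathcal{H}(n)$ (resp. $\mathcal{H}^r(n)$) is the number of non-isomorphic hypergraphs (resp. $r$-uniform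 hypergraphs) on $n$ vertices. $\mathcal{U}_P(n)$ is the number of non-isomorphic $P$-unique hypergraphs on $n$ vertices, and $\mathcal{U}^r_P(n)$ is the number of non-isomorphic $r$-$P$-unique $r$-uniform hypergraphs on $n$ vertices. *)

(* Defs.v *)
From mathcomp Require Import all_boot all_order all_algebra.
From mathcomp Require Import boolp.

Set Implicit Arguments.
Unset Strict Implicit.
Unset Printing Implicit Defensive.

Import GRing.Theory.
Local Open Scope ring_scope.

(* Any set of subsets is allowed, in particular the empty hyperedge. *)
Record hypergraph := Hypergraph {
  vertex : finType;
  hyperedges : {set {set vertex}} }.

Definition isomorphic (H1 H2 : hypergraph) : Prop :=
  exists2 f : vertex H1 -> vertex H2, bijective f &
    forall e : {set vertex H1},
      (e \in hyperedges H1) = (f @: e \in hyperedges H2).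

Definition uniform (r : nat) (H : hypergraph) : bool :=
  [forall e in hyperedges H, #|e| == r].

Definition independent (H : hypergraph) (I : {set vertex H}) : bool :=
  ~~ [exists e in hyperedges H, e \subset I].

Definition ind_num (H : hypergraph) (i : nat) : nat :=
  #|[set I : {set vertex H} | independent I & #|I| == i]|.

Definition ind_poly (H : hypergraph) : {poly int} :=
  \sum_(i < #|vertex H|.+1) (ind_num H i)%:R *: 'X^i.

(* The competitor H1 may have any number of vertices. *)
Definition P_unique (P : hypergraph -> {poly int}) (H : hypergraph) : Prop :=
  forall H1 : hypergraph, P H1 = P H -> isomorphic H1 H.

Definition r_P_unique (r : nat) (P : hypergraph -> {poly int})
    (H : hypergraph) : Prop :=
  uniform r H /\
  forall H1 : hypergraph, uniform r H1 -> P H1 = P H -> isomorphic H1 H.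

(* Every hypergraph on n vertices is isomorphic to one on 'I_n, so the
   non-isomorphic hypergraphs on n vertices with property Q are counted as
   the isomorphism classes of the hypergraphs on 'I_n that satisfy Q. *)
Definition iso_classes (n : nat) (Q : hypergraph -> Prop) : nat :=
  #|equivalence_partition
      (fun E F : {set {set 'I_n}} =>
         `[< isomorphic (Hypergraph E) (Hypergraph F) >])
      [set E : {set {set 'I_n}} | `[< Q (Hypergraph E) >]]|.

Definition num_hypergraphs (n : nat) : nat :=
  iso_classes n (fun _ => True).

Definition num_uniform (r n : nat) : nat :=
  iso_classes n (uniform r).

Definition num_unique (P : hypergraph -> {poly int}) (n : nat) : nat :=
  iso_classes n (P_unique P).

Definition num_r_unique (r : nat) (P : hypergraph -> {poly int}) (n : nat) :
    nat :=
  iso_classes n (r_P_unique r P).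

Lemma isomorphic_refl (H : hypergraph) : isomorphic H H.
Proof.
exists id; first by exists id.
by move=> e; rewrite imset_id.
Qed.

Lemma isomorphic_sym (H1 H2 : hypergraph) :
  isomorphic H1 H2 -> isomorphic H2 H1.
Proof.
case=> f [g fK gK] fE; exists g; first by exists f.
move=> e; rewrite fE -imset_comp.
by rewrite (eq_imset (g := id)) ?imset_id // => x /=; rewrite gK.
Qed.

Lemma isomorphic_trans (H1 H2 H3 : hypergraph) :
  isomorphic H1 H2 -> isomorphic H2 H3 -> isomorphic H1 H3.
Proof.
case=> f bf fE [g bg gE]; exists (g \o f); first exact: bij_comp.
by move=> e; rewrite fE gE -imset_comp.
Qed.

Lemma ind_poly_isomorphic (H1 H2 : hypergraph) :
  isomorphic H1 H2 -> ind_poly H1 = ind_poly H2.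
Proof.
case=> f bf fE; have fI := bij_inj bf; case: (bf) => g fK gK.
rewrite /ind_poly (bij_eq_card bf); apply: eq_bigr => i _; congr (_%:R *: _).
have indE (I : {set vertex H1}) : independent I = independent (f @: I).
  congr (~~ _); apply/exists_inP/exists_inP => -[e eE eI].
    by exists (f @: e); rewrite -?fE ?imsetS.
  have gfK : f @: (g @: e) = e.
    by rewrite -imset_comp (eq_imset (g := id)) ?imset_id // => x /=; rewrite gK.
  exists (g @: e); first by rewrite fE gfK.
  by apply/subsetP => x /imsetP[y /(subsetP eI) /imsetP[z zI ->] ->]; rewrite fK.
rewrite /ind_num -(card_imset _ (imset_inj fI)); apply: eq_card => I.
rewrite inE; apply/imsetP/andP => [[J]|[Iind Icard]].
  by rewrite inE indE => /andP[? ?] ->; rewrite card_imset.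
have gfK : f @: (g @: I) = I.
  by rewrite -imset_comp (eq_imset (g := id)) ?imset_id // => x /=; rewrite gK.
by exists (g @: I); rewrite ?inE ?indE ?gfK // -(card_imset _ fI) gfK Iind.
Qed.

(* Main.v *)
Require Import Defs.
From mathcomp Require Import all_boot all_order all_fingroup all_algebra.
From mathcomp Require Import all_classical all_reals all_analysis.
From mathcomp Require Import zify.

(** A unique hypergraph is determined up to isomorphism by its independence
polynomial, so there are at most as many classes of unique hypergraphs as there
are polynomials available, and both parts compare that number with the number
of all classes. The latter is large: an isomorphism class on n labelled
vertices has at most n! members, so the number of classes is at least the
number of labelled hypergraphs divided by n! ([card_leq_iso_classes]).

For arbitrary hypergraphs the polynomial has n + 1 coefficients between 0 and
2 ^ n, hence takes at most 2 ^ O(n ^ 2) values, against 2 ^ (2 ^ n) / n!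
classes.

For r-uniform hypergraphs that count does not suffice: when r = 2 there are
only 2 ^ 'C(n, 2) labelled hypergraphs, while n + 1 coefficients of n bits each
allow about 2 ^ (n ^ 2) polynomials. Fix k = n / 8 and split according to
whether every independent set has fewer than k elements ([num_r_unique_leq]).
- If so, only the coefficients of index below k can be nonzero, and there are
  at most 2 ^ ((n + 1) k) polynomials, with (n + 1) k about n ^ 2 / 8, well
  below 'C(n, 2) <= 'C(n, r).
- If not, relabelling the vertices makes the first k of them independent. This
  forbids 'C(k, r) edges and leaves only 2 ^ ('C(n, r) - 'C(k, r)) labelled
  hypergraphs.
Both savings are quadratic in n at least, whereas n! is only 2 ^ O(n log n), so
multiplying by n! does no harm. In both parts the ratio is eventually at most
1 / (n + 1), which is what [cvg_nat_ratio0] turns into a limit. *)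

Import Num.Theory GRing.Theory Order.TTheory numFieldNormedType.Exports.

Local Open Scope nat_scope.

(** * Isomorphism classes *)

(** Codes separating the classes bound their number. The code is a relation and
not a function so that a code may also be any isomorphic copy from a restricted
family, without choosing one. *)
Lemma leq_card_classes (T U : finType) (R : rel T) (D : {set T})
    (S : T -> U -> Prop) :
  (forall x, x \in D -> exists u, S x u) ->
  (forall x y u, x \in D -> y \in D -> S x u -> S y u -> R x =1 R y) ->
  #|equivalence_partition R D| <= #|U|.
Proof.
move=> code_ex code_eq; rewrite /equivalence_partition.
set cls := fun x : T => [set y in D | R x y].
pose decode (u : U) :=
  if [pick x in D | `[< S x u >]] is Some x then cls x else finset.set0.
apply: leq_trans (leq_imset_card decode U).
apply/subset_leq_card/fintype.subsetP => _ /imsetP[x xD ->].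
have [u xu] := code_ex x xD; apply/imsetP; exists u => //.
rewrite /decode; case: pickP => [y /andP[yD /asboolP yu]|/(_ x)]; last first.
  by rewrite xD /= (asboolT xu).
by apply/setP => z; rewrite !inE (code_eq x y u).
Qed.

Definition iso_rel (n : nat) : rel {set {set 'I_n}} :=
  fun E F => `[< isomorphic (Hypergraph E) (Hypergraph F) >].

Lemma iso_rel_class (n : nat) (E F : {set {set 'I_n}}) :
  isomorphic (Hypergraph E) (Hypergraph F) -> iso_rel n E =1 iso_rel n F.
Proof.
move=> EF G; apply: asbool_equiv_eq; split; apply: isomorphic_trans => //.
exact: isomorphic_sym.
Qed.

Lemma leq_iso_classes (n : nat) (U : finType) (Q : hypergraph -> Prop)
    (S : {set {set 'I_n}} -> U -> Prop) :
  (forall E, Q (Hypergraph E) -> exists u, S E u) ->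
  (forall E F u, Q (Hypergraph E) -> Q (Hypergraph F) -> S E u -> S F u ->
     isomorphic (Hypergraph E) (Hypergraph F)) ->
  iso_classes n Q <= #|U|.
Proof.
move=> code_ex code_iso; apply: (@leq_card_classes _ _ (iso_rel n) _ S).
  by move=> E; rewrite inE => /asboolP/code_ex.
move=> E F u; rewrite !inE => /asboolP QE /asboolP QF SE SF.
exact/iso_rel_class/(code_iso E F u).
Qed.

(** Every member of the class is the image of E under a permutation of the
vertices. *)
Lemma leq_iso_class_fact (n : nat) (E : {set {set 'I_n}}) :
  #|[set F | iso_rel n E F]| <= n`!.
Proof.
rewrite -card_Sn.
apply: leq_trans (leq_imset_card (fun s : {perm 'I_n} =>
  [set (fun x => s x) @: e | e : {set 'I_n} in E]) _).
apply/subset_leq_card/fintype.subsetP => F; rewrite inE => /asboolP[/= f bf fE].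
apply/imsetP; exists (perm (bij_inj bf)) => //.
have permf (A : {set 'I_n}) : [set perm (bij_inj bf) x | x in A] = f @: A.
  by apply: eq_imset => x; rewrite permE.
have [g fK gK] := bf.
have fgK (A : {set 'I_n}) : f @: (g @: A) = A.
  by rewrite -imset_comp (eq_imset (g := id)) ?imset_id // => x /=; rewrite gK.
apply/setP => e; apply/idP/imsetP => [eF|[e' e'E ->]].
  by exists (g @: e); rewrite ?permf ?fE fgK.
by rewrite permf -fE.
Qed.

Lemma card_leq_iso_classes (n : nat) (Q : hypergraph -> Prop) :
  #|[set E : {set {set 'I_n}} | `[< Q (Hypergraph E) >]]|
    <= iso_classes n Q * n`!.
Proof.
rewrite /iso_classes; set D := [set E | _]; set P := equivalence_partition _ _.
have DP : D \subset finset.cover P.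
  apply/fintype.subsetP => E ED; apply/bigcupP.
  exists [set F in D | iso_rel n E F]; first exact/imset_f.
  by rewrite inE ED; apply/asboolP/isomorphic_refl.
apply: leq_trans (subset_leq_card DP) _.
apply: leq_trans (leq_card_cover P) _.
rewrite -sum_nat_const; apply: leq_sum => _ /imsetP[E _ ->].
apply: leq_trans (leq_iso_class_fact n E); apply: subset_leq_card.
by apply/fintype.subsetP => F; rewrite !inE => /andP[_ /asboolP].
Qed.

(** * Codes for unique hypergraphs *)

Lemma card_sets (T : finType) : #|{: {set T}}| = 2 ^ #|T|.
Proof. by rewrite -(cardsT T) -card_powerset powersetT cardsT. Qed.

Definition small_independent_sets (k : nat) (H : hypergraph) : bool :=
  [forall I : {set vertex H}, independent I ==> (#|I| < k)].

(** The coefficients of index below k of the independence polynomial, stored in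
a finite type; [inord] loses nothing because they count subsets of 'I_n. *)
Definition truncated_ind_nums (k n : nat) (E : {set {set 'I_n}}) :
    {ffun 'I_k -> 'I_(2 ^ n).+1} :=
  [ffun i : 'I_k => inord (ind_num (Hypergraph E) i)].

Lemma truncated_ind_nums_inj (k n : nat) (E F : {set {set 'I_n}}) :
  small_independent_sets k (Hypergraph E) ->
  small_independent_sets k (Hypergraph F) ->
  truncated_ind_nums k n E = truncated_ind_nums k n F ->
  ind_poly (Hypergraph E) = ind_poly (Hypergraph F).
Proof.
have ind0 (G : {set {set 'I_n}}) i : small_independent_sets k (Hypergraph G) ->
    k <= i -> ind_num (Hypergraph G) i = 0.
  move=> /forallP smallG ki; apply/eqP; rewrite cards_eq0; apply/eqP/setP => I.
  rewrite !inE; apply/negP => /andP[indI /eqP cardI].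
  by have := implyP (smallG I) indI; rewrite cardI ltnNge ki.
have indS (G : {set {set 'I_n}}) i : ind_num (Hypergraph G) i < (2 ^ n).+1.
  by rewrite ltnS (leq_trans (max_card _)) // card_sets card_ord.
move=> smallE smallF /ffunP EF; apply: eq_bigr => -[i _] _ /=.
congr (_%:R *: _)%R; have [ki|ik] := leqP k i; first by rewrite !ind0.
have := EF (Ordinal ik); rewrite !ffunE => /(congr1 val).
by rewrite /= !inordK.
Qed.

Lemma card_truncated_ind_nums (k n : nat) :
  #|{ffun 'I_k -> 'I_(2 ^ n).+1}| = (2 ^ n).+1 ^ k.
Proof. by rewrite card_ffun !card_ord. Qed.

Lemma uniform_isomorphic (r : nat) (H1 H2 : hypergraph) :
  isomorphic H1 H2 -> uniform r H2 -> uniform r H1.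
Proof.
move=> [f /bij_inj fI fE] /forall_inP unif; apply/forall_inP => e.
by rewrite fE => /unif; rewrite card_imset.
Qed.

Definition initial_set (k n : nat) : {set 'I_n} := [set i : 'I_n | i < k].

Lemma card_initial_set (k n : nat) : k <= n -> #|initial_set k n| = k.
Proof.
move=> kn; have -> : initial_set k n = [set widen_ord kn i | i in 'I_k].
  apply/setP => i; rewrite inE; apply/idP/imsetP => [ik|[j _ ->]].
    by exists (Ordinal ik) => //; apply: val_inj.
  exact: (ltn_ord j).
rewrite card_imset ?card_ord // => i j /(congr1 val) ij; exact: val_inj.
Qed.

(** Relabel the vertices by listing an independent set with at least k elements
before all others. *)
Lemma ex_isomorphic_initial_independent (k n : nat) (E : {set {set 'I_n}}) :
  ~~ small_independent_sets k (Hypergraph E) ->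
  exists F : {set {set 'I_n}}, isomorphic (Hypergraph F) (Hypergraph E) /\
    @independent (Hypergraph F) (initial_set k n).
Proof.
move=> /forallPn[I]; rewrite negb_imply -leqNgt => /andP[indI kI].
pose s := enum I ++ enum (~: I).
have size_s : size s = n by rewrite size_cat -!cardE cardsC card_ord.
have uniq_s : uniq s.
  rewrite cat_uniq !enum_uniq andbT /=; apply/hasPn => x /=.
  by rewrite !mem_enum inE.
pose f (i : 'I_n) := nth i s i.
have fI : injective f.
  move=> i j; rewrite /f (set_nth_default j) ?size_s // => /eqP.
  by rewrite nth_uniq ?size_s // => /eqP/val_inj.
exists [set e : {set 'I_n} | f @: e \in E]; split.
  by exists f; [exact: injF_bij | move=> e; rewrite inE].
apply/exists_inP => -[e]; rewrite inE => fe eI; move/negP: indI; apply.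
apply/exists_inP; exists (f @: e) => //.
apply/fintype.subsetP => _ /imsetP[i ie ->].
have := fintype.subsetP eI i ie; rewrite inE => ik.
have iI : i < size (enum I) by rewrite -cardE (leq_trans ik).
by rewrite /f nth_cat iI -mem_enum mem_nth.
Qed.

Definition initial_independent_uniform (r k n : nat) : {set {set {set 'I_n}}} :=
  [set F | uniform r (Hypergraph F)
         & @independent (Hypergraph F) (initial_set k n)].

(** An r-set inside the initial set would be an edge contained in an independent
set, so the edges are chosen among the remaining r-sets. *)
Lemma card_initial_independent_uniform (r k n : nat) : k <= n ->
  #|initial_independent_uniform r k n| <= 2 ^ ('C(n, r) - 'C(k, r)).
Proof.
move=> kn.
pose all_edges := [set e : {set 'I_n} | #|e| == r].
pose inner := [set e : {set 'I_n} | e \subset initial_set k n & #|e| == r].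
have inS : inner \subset all_edges.
  by apply/fintype.subsetP => e; rewrite !inE => /andP[].
have <- : #|all_edges :\: inner| = 'C(n, r) - 'C(k, r).
  rewrite cardsD (finset.setIidPr inS) card_draws card_ord.
  by rewrite cards_draws card_initial_set.
rewrite -card_powerset; apply/subset_leq_card/fintype.subsetP => F.
rewrite !inE => /andP[/forall_inP unifF /exists_inP indF].
apply/fintype.subsetP => e eF; rewrite !inE (eqP (unifF e eF)) eqxx !andbT.
by apply/negP => eI; apply: indF; exists e.
Qed.

(** The code is the truncated polynomial when all independent sets have fewer
than k elements, and otherwise an isomorphic copy in which the first k vertices
are independent. Equal codes give isomorphic hypergraphs by uniqueness in the
first case, by transitivity in the second. *)
Lemma num_r_unique_leq (r k n : nat) : k <= n ->
  num_r_unique r ind_poly n <= (2 ^ n).+1 ^ k + 2 ^ ('C(n, r) - 'C(k, r)).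
Proof.
move=> kn; pose V := {F | F \in initial_independent_uniform r k n}.
pose S (E : {set {set 'I_n}}) (u : {ffun 'I_k -> 'I_(2 ^ n).+1} + V) :=
  match u with
  | inl c => small_independent_sets k (Hypergraph E) /\
             truncated_ind_nums k n E = c
  | inr F => isomorphic (Hypergraph (val F)) (Hypergraph E)
  end.
apply: leq_trans (@leq_iso_classes n _ _ S _ _) _.
- move=> E [unifE _].
  have [smallE|/ex_isomorphic_initial_independent[F [FE indF]]] :=
    boolP (small_independent_sets k (Hypergraph E)).
    by exists (inl (truncated_ind_nums k n E)).
  have FV : F \in initial_independent_uniform r k n.
    by rewrite inE indF (uniform_isomorphic _ _ _ FE).
  by exists (inr (exist _ F FV)).
- move=> E F [c|G] [unifE _] [unifF uniqF] /=.
    move=> [smallE <-] [smallF /esym codeEF]; apply: uniqF => //.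
    exact: (truncated_ind_nums_inj k).
  by move=> /isomorphic_sym EG GF; apply: isomorphic_trans EG GF.
rewrite card_sum card_truncated_ind_nums leq_add2l card_sig.
exact: card_initial_independent_uniform.
Qed.

(** No set of vertices has n + 1 elements, so truncation at n + 1 keeps the
whole polynomial. *)
Lemma num_unique_leq (n : nat) : num_unique ind_poly n <= (2 ^ n).+1 ^ n.+1.
Proof.
rewrite -card_truncated_ind_nums.
have small (E : {set {set 'I_n}}) : small_independent_sets n.+1 (Hypergraph E).
  by apply/forallP => I; rewrite ltnS implybE -[leqRHS]card_ord max_card orbT.
apply: (@leq_iso_classes n _ _ (fun E c => truncated_ind_nums n.+1 n E = c)).
  by move=> E _; exists (truncated_ind_nums n.+1 n E).
move=> E F c _ uniqF codeE codeF; apply: uniqF.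
by apply: (truncated_ind_nums_inj n.+1); rewrite ?small // codeE.
Qed.

(** * Comparison of the growth rates *)

Lemma num_hypergraphs_geq (n : nat) : 2 ^ (2 ^ n) <= num_hypergraphs n * n`!.
Proof.
apply: leq_trans (card_leq_iso_classes n (fun=> True)).
rewrite -[X in 2 ^ 2 ^ X]card_ord -!card_sets; apply/subset_leq_card.
by apply/fintype.subsetP => E _; rewrite inE; apply/asboolP.
Qed.

Lemma num_uniform_geq (r n : nat) : 2 ^ 'C(n, r) <= num_uniform r n * n`!.
Proof.
apply: leq_trans (card_leq_iso_classes n (uniform r)).
rewrite -[X in 'C(X, r)]card_ord -card_draws -card_powerset.
apply/subset_leq_card/fintype.subsetP => E; rewrite !inE => /fintype.subsetP Er.
by apply/forall_inP => e /Er; rewrite inE.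
Qed.

Lemma leq_mul_exp2 (c n : nat) : 0 < c -> 2 * c <= n -> c * n <= 2 ^ n.
Proof.
move=> c0 cn; have [d nE] : exists d, n = c + d by exists (n - c); lia.
have dbl (m : nat) : 0 < m -> m + m <= 2 ^ m.
  by elim: m => [//|[//|m] IH] _; have := IH isT; rewrite [2 ^ m.+2]expnS; lia.
rewrite nE expnD; apply: leq_mul; first exact/ltnW/ltn_expl.
by apply: leq_trans (dbl d _); lia.
Qed.

(** The elementary form of log n = o(n): the logarithm of n is below n / c for
every fixed c, once n is large. *)
Lemma leq_exp2_divn (c n : nat) : 0 < c -> 4 * c * c <= n -> n <= 2 ^ (n %/ c).
Proof.
move=> c0 cn; have le_div : 4 * c <= n %/ c by rewrite leq_divRL.
have lt_n : n < (n %/ c).+1 * c by rewrite -ltn_divLR.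
by apply: leq_trans (leq_mul_exp2 (2 * c) (n %/ c) _ _); nia.
Qed.

Lemma fact_leq_exp2 (c n : nat) :
  0 < c -> 4 * c * c <= n -> n`! <= 2 ^ (n %/ c * n).
Proof.
move=> c0 cn; have fact_leq (m : nat) : m`! <= m ^ m.
  elim: m => // m IH; rewrite factS expnS leq_mul2l /=.
  by apply: leq_trans IH _; case: m => // m; rewrite leq_exp2r.
apply: leq_trans (fact_leq n) _; rewrite expnM.
by case: n cn => // n cn; rewrite leq_exp2r // leq_exp2_divn.
Qed.

(** Binomial coefficients increase up to the middle of the row, so r = 2 is the
worst uniformity for the estimates. *)
Lemma leq_bin2r_low (r n : nat) : 2 <= r -> 2 * r <= n -> 'C(n, 2) <= 'C(n, r).
Proof.
elim: r => // r IH; rewrite leq_eqVlt => /orP[/eqP[<-] //|r2] rn.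
apply: (leq_trans (IH r2 _)); first by lia.
have := mul_bin_left n r; have : r.+1 <= n - r by lia.
by move: ('C(n, r)) ('C(n, r.+1)) => a b; nia.
Qed.

Lemma expn2S_leq (n k : nat) : (2 ^ n).+1 ^ k <= 2 ^ (n.+1 * k).
Proof.
case: k => [|k]; first by rewrite muln0.
by rewrite expnM leq_exp2r // expnS mul2n -addnn -addn1 leq_add2l expn_gt0.
Qed.

Lemma num_unique_mulS_leq (n : nat) : 36 <= n ->
  num_unique ind_poly n * n.+1 <= num_hypergraphs n.
Proof.
move=> n36; rewrite -(leq_pmul2r (fact_gt0 n)).
apply: leq_trans (num_hypergraphs_geq n).
have n3 : n * n * n <= 2 ^ n.
  (* n <= 2 ^ (n / 3) for n >= 36; take cubes *)
  have -> : n * n * n = n ^ 3 by rewrite !expnS expn0 muln1 mulnA.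
  apply: leq_trans (leq_pexp2l _ (leq_divM n 3)) => //.
  by rewrite expnM leq_exp2r // leq_exp2_divn.
apply: (@leq_trans (2 ^ (n.+1 * n.+1 + n + n * n))); last first.
  by rewrite leq_exp2l //; apply: leq_trans n3; nia.
rewrite !expnD; apply: leq_mul; last first.
  by have := fact_leq_exp2 1 n isT; rewrite divn1; apply; lia.
apply: leq_mul; last exact: ltn_expl.
exact: leq_trans (num_unique_leq n) (expn2S_leq _ _).
Qed.

(** With s = n (n / 1024) + n, the power 2 ^ s absorbs (n + 1) n!. For k = n / 8
both estimates leave room for it: (n + 1) k + s is below 'C(n, 2), about
n ^ 2 / 2, and s is below 'C(k, 2), about n ^ 2 / 128. The threshold
2 ^ 22 = 4 * 1024 ^ 2 is that of [fact_leq_exp2] for c = 1024, and 16 r makes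
k >= 2 r. *)
Lemma num_r_unique_mulS_leq (r n : nat) : 2 <= r -> 2 ^ 22 + 16 * r <= n ->
  num_r_unique r ind_poly n * n.+1 <= num_uniform r n.
Proof.
move=> r2 nr; rewrite -(leq_pmul2r (fact_gt0 n)).
apply: leq_trans (num_uniform_geq r n).
pose k := n %/ 8; pose q := n %/ 1024; pose s := n + q * n.
have [kn nk] : k * 8 <= n /\ n < k.+1 * 8 by rewrite leq_divM ltn_ceil.
have qn : q * 1024 <= n by rewrite leq_divM.
have n_big : 2 ^ 22 <= n by apply: leq_trans nr; apply: leq_addr.
have nr' : 16 * r <= n by apply: leq_trans nr; apply: leq_addl.
have n_big' : 4 * 1024 * 1024 <= n by apply: leq_trans n_big; vm_compute.
have n1000 : 1000 <= n by lia.
clear nr n_big.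
have sP : n.+1 * n`! <= 2 ^ s.
  by rewrite expnD; apply: leq_mul; [exact: ltn_expl|exact: fact_leq_exp2].
clear n_big'.
have := leq_bin2r_low r n r2; have := leq_bin2r_low r k r2.
rewrite !bin2 => Kr Nr.
have KN : 'C(k, r) <= 'C(n, r) by apply: leq_bin2l; lia.
have sK : s.+1 <= 'C(k, r).
  apply: leq_trans (Kr _); last by lia.
  rewrite geq_half_double.
  have h1 : q * 128 <= k by lia.
  have k40 : 125 <= k by lia.
  clear -h1 k40 nk; rewrite /s; nia.
have sN : (n.+1 * k + s).+1 <= 'C(n, r).
  apply: leq_trans (Nr _); last by lia.
  by rewrite geq_half_double /s; clear -kn qn n1000; nia.
clearbody k.
rewrite -mulnA.
apply: (leq_trans (leq_mul (num_r_unique_leq r k n _) sP)); first lia.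
(* each of the two summands takes half of 2 ^ 'C(n, r) *)
rewrite mulnDl.
have -> : 2 ^ 'C(n, r) = 2 ^ ('C(n, r)).-1 + 2 ^ ('C(n, r)).-1.
  by rewrite addnn -mul2n -expnS prednK //; apply: leq_trans sN.
apply: leq_add; last by rewrite -expnD leq_exp2l //; lia.
apply: leq_trans (leq_mul (expn2S_leq _ _) (leqnn _)) _.
by rewrite -expnD leq_exp2l //; lia.
Qed.

(** * The limits *)

Local Open Scope classical_set_scope.
Local Open Scope ring_scope.

Lemma cvg_nat_ratio0 (R : realType) (u v : nat -> nat) (n0 : nat) :
  (forall n, (n0 <= n)%N -> (u n * n.+1 <= v n)%N) ->
  ((u n)%:R / (v n)%:R : R) @[n --> \oo] --> (0 : R).
Proof.
move=> uv; apply: (@squeeze_cvgr _ _ _ _ (fun=> 0) harmonic).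
- exists n0 => // n /= /uv uvn; rewrite divr_ge0 ?ler0n //=.
  have [->|v0] := posnP (v n); first by rewrite invr0 mulr0 invr_ge0.
  by rewrite ler_pdivrMr ?ltr0n // mulrC ler_pdivlMr ?ltr0n // -natrM ler_nat.
- exact: cvg_cst.
- exact: cvg_harmonic.
Qed.

Theorem theorem4 (R : realType) :
  ((num_unique ind_poly n)%:R / (num_hypergraphs n)%:R : R)
      @[n --> \oo] --> (0 : R)
  /\
  (forall r : nat, (2 <= r)%N ->
     ((num_r_unique r ind_poly n)%:R / (num_uniform r n)%:R : R)
        @[n --> \oo] --> (0 : R)).
Proof.
split=> [|r r2]; apply: cvg_nat_ratio0; first exact: num_unique_mulS_leq.
by move=> n; apply: num_r_unique_mulS_leq.
Qed.
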